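(* Let $G$ be a finite simple biconnected graph with at least $3$ vertices. If $G$ is not an elementary cycle, then $G$ is not separable.
   Context: A graph is biconnected if it is connected and has no cut-point (a vertex whose removal increases the number of connected components). A graph $G=(V,E)$ is separable if there exist non-negative real weights $w(e)$, $e\in E$, and a threshold $\alpha\in\mathbb{R}$ such that for every $E'\subseteq E$: $\sum_{e\in E'}w(e)\ge\alpha$ if and only if the spanning subgraph $(V,E')$ is connected. *)

(* Defs.v *)
From HB Require Import structures.
From mathcomp Require Import all_boot all_order all_algebra.
From mathcomp Require Import reals.

Set Implicit Arguments.
Unset Strict Implicit.
Unset Printing Implicit Defensive.

Import Order.TTheory GRing.Theory Num.Theory.

Section Graphs.
Variable V : finType.
Implicit Types (E : {set {set V}}) (D : {set V}) (x y v : V).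

(* A graph with vertex set V is given by its set of edges, each edge being the
   unordered pair of its ends; asking for exactly two ends excludes loops. *)
Definition simple_graph E : Prop := forall f : {set V}, f \in E -> #|f| = 2.

Definition adjacent E : rel V := [rel x y | [set x; y] \in E].

Definition graph_connected E : Prop := forall x y, connect (adjacent E) x y.

(* Number of connected components of the subgraph of (V, E) induced by D.
   Restricting both ends to D makes D closed, as n_comp requires. *)
Definition ncomponents E D : nat :=
  n_comp [rel x y | [&& x \in D, y \in D & adjacent E x y]] D.

Definition cut_point E v : Prop :=
  ncomponents E [set: V] < ncomponents E ([set: V] :\ v).

Definition biconnected E : Prop :=
  graph_connected E /\ ~ (exists v, cut_point E v).

(* c lists all vertices once, and the edges join cyclically consecutive ones. *)
Definition elementary_cycle E : Prop :=
  exists c : seq V,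
    [/\ 2 < size c, uniq c, forall v, v \in c
      & E = [set [set x; next c x] | x : V]].

(* The weight function is total on sets of vertices, but only its values on
   elements of E are used. *)
Definition separable_graph (R : realType) E : Prop :=
  exists (w : {set V} -> R) (alpha : R),
    (forall f, f \in E -> (0 <= w f)%R) /\
    (forall E' : {set {set V}}, E' \subset E ->
       ((alpha <= \sum_(f in E') w f)%R <-> graph_connected E')).

End Graphs.

(* Main.v *)
(* If V splits into connected blocks U, W, Z with at least two edges between U
   and Z and at least two between W and Z, then E is not separable: see
   blocks_not_separable. Such blocks arise from a connected Z whose complement is
   disconnected (take two components U, W of the complement and let the rest be
   the third block; absence of cut-points provides the two edges), and from a
   Hamiltonian cycle with a chord (U and W are the two open arcs). So assume that
   E is separable. If two vertices u, v are not adjacent, then V - {u, v} is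
   disconnected, and a path from u to v through either part must cover that part,
   which gives a Hamiltonian cycle; a complete graph has one trivially. This cycle
   has no chord, hence it is the whole graph. *)

Require Import Defs.
From mathcomp Require Import all_boot all_order all_algebra.
From mathcomp Require Import reals lra.

Import Order.TTheory GRing.Theory Num.Theory.

Set Implicit Arguments.
Unset Strict Implicit.
Unset Printing Implicit Defensive.

(** Follow the path up to its first vertex outside [S]. Often [S] is a set of reachable vertices,
    and the edge leaving it is what matters. *)
Lemma connect_exit (T : finType) (e : rel T) (S : {set T}) x y :
  connect e x y -> x \in S -> y \notin S ->
  exists s t, [/\ s \in S, t \notin S & e s t].
Proof.
case/connectP=> p; elim: p x => [|z p IHp] x /=.
  by move=> _ -> ->.
case/andP=> exz pz lastp xS yS.
case zS: (z \in S); first exact: IHp pz lastp zS yS.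
by exists x, z; rewrite xS zS.
Qed.

(** * Connectivity inside a vertex set, and edges between sets *)

Section Graph.
Variables (V : finType) (E : {set {set V}}).
Implicit Types (A B D K L U W Z : {set V}) (x y z u v : V) (f g : {set V}).

(** The relation whose components [ncomponents] counts, named so that the absence of cut-points
    becomes a statement about paths. *)
Definition induced D : rel V :=
  [rel x y | [&& x \in D, y \in D & adjacent E x y]].

Definition connected_in D :=
  forall x y, x \in D -> y \in D -> connect (induced D) x y.

Definition link f A B :=
  exists x y, [/\ x \in A, y \in B, f = [set x; y] & f \in E].

Definition doubly_linked A B :=
  exists f g, [/\ f != g, link f A B & link g A B].

Lemma adjacentC : symmetric (adjacent E).
Proof. by move=> x y; rewrite /adjacent /= setUC. Qed.

Lemma induced_connectC D : connect_sym (induced D).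
Proof.
apply: sym_connect_sym => x y.
by rewrite /induced /= -!/(adjacent E _ _) adjacentC andbCA.
Qed.

Lemma connect_inducedS A B x y :
  A \subset B -> connect (induced A) x y -> connect (induced B) x y.
Proof.
move=> sAB; apply: connect_sub => s t /and3P[sA tA st].
by apply: connect1; apply/and3P; rewrite !(subsetP sAB).
Qed.

Lemma connect_induced_mem D x y :
  x \in D -> connect (induced D) x y -> y \in D.
Proof.
move=> xD cxy; apply: contraT => yD.
have [s [t [_ /negP tD /and3P[_ /tD]]]] := connect_exit cxy xD yD.
by [].
Qed.

Lemma connected_in_center D z :
  (forall x, x \in D -> connect (induced D) x z) -> connected_in D.
Proof.
move=> cz x y xD yD; apply: connect_trans (cz x xD) _.
by rewrite induced_connectC cz.
Qed.

Lemma connected_in_path x p :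
  path (adjacent E) x p -> connected_in [set y in x :: p].
Proof.
move=> ep; apply: (@connected_in_center _ x) => y; rewrite inE => yp.
rewrite induced_connectC; apply: (@path_connect _ _ x p) => //.
apply: (sub_in_path (P := mem (x :: p))) ep; last by apply/allP.
by move=> s t sp tp st; rewrite /induced /= !inE -!in_cons sp tp.
Qed.

(** The vertices reachable from [a] within [A] form such a [U]: a path inside [A] starting at [a]
    never leaves [U], so it is also a path of the subgraph induced by [U]. *)
Lemma component_of a A : a \in A ->
  exists U, [/\ a \in U, U \subset A, connected_in U
    & forall s t, s \in A -> t \in U -> adjacent E s t -> s \in U].
Proof.
move=> aA; pose U := [set z | connect (induced A) a z].
have aU : a \in U by rewrite inE.
have sUA : U \subset A.
  by apply/subsetP => z; rewrite inE; apply: connect_induced_mem.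
have clU s t : s \in A -> t \in U -> adjacent E s t -> s \in U.
  move=> sA tU st; have tA := subsetP sUA t tU.
  rewrite !inE in tU *; apply: connect_trans tU _; apply: connect1.
  by apply/and3P; rewrite adjacentC.
exists U; split=> //; apply: (@connected_in_center _ a) => y yU.
rewrite induced_connectC; apply: contraT => ncay.
pose S := [set z in U | connect (induced U) a z].
have yS : y \notin S by rewrite inE negb_and ncay orbT.
have aS : a \in S by rewrite inE aU /=.
have cay : connect (induced A) a y by rewrite inE in yU.
have [s [t [sS /negP tS /and3P[sA tA st]]]] := connect_exit cay aS yS.
have /andP[sU cas] : (s \in U) && connect (induced U) a s by rewrite inE in sS.
have tU : t \in U by apply: (clU t s) => //; rewrite adjacentC.
case: tS; rewrite inE tU /=; apply: connect_trans cas _.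
by apply: connect1; apply/and3P.
Qed.

(** A connected graph has at most one component, so if deleting [v] left two or more, [v] would be a
    cut-point. *)
Lemma biconnected_del v : biconnected E -> connected_in [set~ v].
Proof.
case=> connE ncut x y xv yv.
have sameE : [set: V] :\ v = [set~ v] by apply/setP=> z; rewrite !inE andbT.
have le1 : ncomponents E [set~ v] <= 1.
  rewrite leqNgt; apply/negP => gt1; apply: ncut; exists v.
  rewrite /cut_point sameE; apply: leq_trans gt1; rewrite ltnS.
  (* Components are counted by their roots, and connectivity makes any two roots of the whole graph
     equal. *)
  apply/card_le1_eqP => s t /andP[/eqP rs _] /andP[/eqP rt _].
  rewrite -rs -rt; apply/fingraph.rootP; first exact: (@induced_connectC setT).
  suff sub : subrel (adjacent E) (connect (induced setT)).
    exact: (connect_sub sub (connE t s)).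
  by move=> i j ij; apply: connect1; apply/and3P; rewrite !inE.
apply/(fingraph.rootP (@induced_connectC _)).
have rootD z : z \in [set~ v] ->
    fingraph.root (induced [set~ v]) z \in
      predI (roots (induced [set~ v])) (mem [set~ v]).
  move=> zv; rewrite inE /= roots_root; last exact: induced_connectC.
  exact: (connect_induced_mem zv (connect_root _ _)).
by apply: (card_le1_eqP le1); apply: rootD.
Qed.

Definition inner D : {set {set V}} := [set f in E | f \subset D].

Lemma connect_inner D (E' : {set {set V}}) x y :
  inner D \subset E' -> connect (induced D) x y -> connect (adjacent E') x y.
Proof.
move=> sDE; apply: connect_sub => s t /and3P[sD tD st].
apply: connect1; rewrite /adjacent /=; apply: (subsetP sDE).
by rewrite inE [_ \in E]st subUset !sub1set sD.
Qed.

Lemma connect_link (E' : {set {set V}}) f A B x z :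
  connected_in A -> connected_in B -> inner A \subset E' ->
  inner B \subset E' -> link f A B -> f \in E' -> x \in A -> z \in B ->
  connect (adjacent E') x z.
Proof.
move=> cA cB sA sB [a [b [aA bB -> _]]] fE' xA zB.
apply: connect_trans (connect_inner sA (cA _ _ xA aA)) _.
apply: connect_trans (connect_inner sB (cB _ _ bB zB)).
exact: connect1.
Qed.

End Graph.

(** * Exchanging edges between three blocks *)

Lemma separated_not_connected (V : finType) (E' : {set {set V}})
    (W : {set V}) x y :
    x \in W -> y \notin W ->
    (forall f, f \in E' -> f \subset W \/ f \subset ~: W) ->
  ~ graph_connected E'.
Proof.
move=> xW yW sepW connE.
have [s [t [sW tW /sepW]]] := connect_exit (connE x y) xW yW.
by case; rewrite subUset !sub1set ?inE ?sW ?(negPf tW) ?andbF.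
Qed.

(* With F the edges inside the blocks, f1, f2 joining U to Z and g1, g2 joining
   W to Z, the sets F + f1 + g1 and F + f2 + g2 are connected while F + f1 + f2
   and F + g1 + g2 are not; yet both pairs have the same total weight. *)
Lemma blocks_not_separable (R : realType) (V : finType) (E : {set {set V}})
    (U W Z : {set V}) :
    connected_in E U -> connected_in E W -> connected_in E Z ->
    [disjoint U & W] -> [disjoint U & Z] -> [disjoint W & Z] ->
    (forall v, [|| v \in U, v \in W | v \in Z]) ->
    doubly_linked E U Z -> doubly_linked E W Z ->
  ~ separable_graph R E.
Proof.
move=> cU cW cZ dUW dUZ dWZ cover [f1 [f2 [nef f1P f2P]]].
move=> [g1 [g2 [neg g1P g2P]]] [w [alpha [_ thr]]].
pose F := inner E U :|: inner E W :|: inner E Z.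
have sUF : inner E U \subset F by rewrite /F -setUA subsetUl.
have sWF : inner E W \subset F by rewrite /F setUAC subsetUr.
have sZF : inner E Z \subset F by rewrite subsetUr.
have Fblock h : h \in F -> [\/ h \subset U, h \subset W | h \subset Z].
  rewrite !inE => /orP[/orP[]|] /andP[_ ?]; first exact: Or31.
    exact: Or32.
  exact: Or33.
have sFE : F \subset E.
  by apply/subsetP => h; rewrite !inE => /orP[/orP[]|] /andP[].
clearbody F.
have linkE A B h : link E h A B -> h \in E by case=> ? [? []].
have fnF h : link E h U Z -> h \notin F.
  case=> x [z [xU zZ -> _]]; apply/negP => /Fblock.
  case; rewrite subUset !sub1set => /andP[xB zB].
  - by rewrite (disjointFl dUZ zZ) in zB.
  - by rewrite (disjointFr dUW xU) in xB.
  - by rewrite (disjointFr dUZ xU) in xB.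
have gnF h : link E h W Z -> h \notin F.
  case=> x [z [xW zZ -> _]]; apply/negP => /Fblock.
  case; rewrite subUset !sub1set => /andP[xB zB].
  - by rewrite (disjointFl dUW xW) in xB.
  - by rewrite (disjointFl dWZ zZ) in zB.
  - by rewrite (disjointFr dWZ xW) in xB.
have nefg h k : link E h U Z -> link E k W Z -> h != k.
  case=> x [z [xU zZ -> _]] [x' [z' [xW zZ' -> _]]].
  apply/eqP => /setP/(_ x); rewrite !inE eqxx /=.
  case: eqP xW => [<-|_ _]; first by rewrite (disjointFr dUW xU).
  by case: eqP zZ' => [<-|//]; rewrite (disjointFr dUZ xU).
have sum2 h k : h != k -> h \notin F -> k \notin F ->
    (\sum_(i in h |: (k |: F)) w i = w h + (w k + \sum_(i in F) w i))%R.
  move=> nehk hF kF; rewrite big_setU1; last by rewrite in_setU1 negb_or nehk.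
  by rewrite big_setU1.
have sub2 h k : h \in E -> k \in E -> h |: (k |: F) \subset E.
  by move=> hE kE; rewrite !subUset !sub1set hE kE sFE.
have ge2 h k : link E h U Z -> link E k W Z ->
    (alpha <= w h + (w k + \sum_(i in F) w i))%R.
  move=> hP kP; rewrite -(sum2 _ _ (nefg _ _ hP kP) (fnF _ hP) (gnF _ kP)).
  apply/(thr _ (sub2 _ _ (linkE _ _ _ hP) (linkE _ _ _ kP))).
  have sF : F \subset h |: (k |: F) by rewrite setUA subsetUr.
  (* The end [z] of [h] serves as a hub: a vertex of [U] reaches it through [h], one of [W] through
     [k], one of [Z] inside [Z]. *)
  have [_ [z [_ zZ _ _]]] := hP.
  have toz x : connect (adjacent (h |: (k |: F))) x z.
    case/or3P: (cover x) => xB.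
    - apply: (connect_link cU cZ _ _ hP) => //.
      + exact: subset_trans sF.
      + exact: subset_trans sF.
      + by rewrite !inE eqxx.
    - apply: (connect_link cW cZ _ _ kP) => //.
      + exact: subset_trans sF.
      + exact: subset_trans sF.
      + by rewrite !inE eqxx orbT.
    - apply: (connect_inner _ (cZ _ _ xB zZ)).
      exact: subset_trans sF.
  move=> x y; apply: connect_trans (toz x) _.
  by rewrite (sym_connect_sym (@adjacentC _ _)) toz.
(* [A] is the block avoided by both extra edges, so no chosen edge leaves it. It will be [W] for the
   pair [f1], [f2] and [U] for [g1], [g2]. *)
have lt2 (A : {set V}) a z f g : a \in A -> z \notin A ->
    (forall i, i \in F -> i \subset A \/ i \subset ~: A) ->
    f != g -> f \in E -> g \in E -> f \notin F -> g \notin F ->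
    f \subset ~: A -> g \subset ~: A ->
    (w f + (w g + \sum_(i in F) w i) < alpha)%R.
  move=> aA zA sepF nehk hE kE hF kF hA kA.
  rewrite -(sum2 _ _ nehk hF kF) ltNge; apply/negP => /(thr _ (sub2 _ _ hE kE)).
  apply: (separated_not_connected aA zA).
  by move=> i /setU1P[->|/setU1P[->|/sepF]]; auto.
have offD (A B i : {set V}) :
    [disjoint B & A] -> i \subset B -> i \subset ~: A.
  by rewrite disjoints_subset => BA iB; apply: (subset_trans iB BA).
have ltW : (w f1 + (w f2 + \sum_(i in F) w i) < alpha)%R.
  have [x [z [xW zZ _ _]]] := g1P.
  have offW h : link E h U Z -> h \subset ~: W.
    case=> a [b [aU bZ -> _]]; rewrite subUset !sub1set !inE.
    by rewrite (disjointFr dUW aU) (disjointFl dWZ bZ).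
  apply: (lt2 W x z _ _ xW _ _ nef (linkE _ _ _ f1P) (linkE _ _ _ f2P)
    (fnF _ f1P) (fnF _ f2P) (offW _ f1P) (offW _ f2P)).
    by rewrite (disjointFl dWZ zZ).
  move=> i /Fblock[iB|iB|iB]; [right|left|right] => //; apply: offD iB => //.
  by rewrite disjoint_sym.
have ltU : (w g1 + (w g2 + \sum_(i in F) w i) < alpha)%R.
  have [x [z [xU zZ _ _]]] := f1P.
  have offU h : link E h W Z -> h \subset ~: U.
    case=> a [b [aW bZ -> _]]; rewrite subUset !sub1set !inE.
    by rewrite (disjointFl dUW aW) (disjointFl dUZ bZ).
  apply: (lt2 U x z _ _ xU _ _ neg (linkE _ _ _ g1P) (linkE _ _ _ g2P)
    (gnF _ g1P) (gnF _ g2P) (offU _ g1P) (offU _ g2P)).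
    by rewrite (disjointFl dUZ zZ).
  move=> i /Fblock[iB|iB|iB]; [left|right|right] => //; apply: offD iB => //;
    by rewrite disjoint_sym.
have := ge2 _ _ f1P g1P; have := ge2 _ _ f2P g2P.
lra.
Qed.

(** * Connected sets with disconnected complement *)

Section NonSeparability.
Variables (R : realType) (V : finType) (E : {set {set V}}).
Hypothesis biconnE : biconnected E.
Implicit Types (A B K L U W Z : {set V}) (u v x y z : V) (c p q : seq V).

(** Connectivity gives an edge from [U] to some [z1] in [Z]. Deleting [z1] keeps [a] and [b]
    connected, which forces another edge out of [U], ending at a vertex of [Z] other than [z1]. *)
Lemma doubly_linked_component U Z a b :
    a \in U -> b \notin U -> b \notin Z -> [disjoint U & Z] ->
    (forall s t, s \in U -> t \notin U -> adjacent E s t -> t \in Z) ->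
  doubly_linked E U Z.
Proof.
move=> aU bU bZ dUZ outU; have [connE _] := biconnE.
have [x1 [z1 [x1U z1U e1]]] := connect_exit (connE a b) aU bU.
have z1Z := outU _ _ x1U z1U e1.
have az1 : a \in [set~ z1] by rewrite !inE; apply: contraNneq z1U => <-.
have bz1 : b \in [set~ z1] by rewrite !inE; apply: contraNneq bZ => ->.
have cab := biconnected_del biconnE az1 bz1.
have [x2 [z2 [x2U z2U /and3P[_ z2z1 e2]]]] := connect_exit cab aU bU.
have z2Z := outU _ _ x2U z2U e2.
exists [set x1; z1], [set x2; z2]; split.
- apply/eqP => /setP/(_ z2); rewrite !inE eqxx orbT in z2z1 *.
  rewrite (negPf z2z1) orbF => /eqP z2x1.
  by rewrite z2x1 x1U in z2U.
- by exists x1, z1.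
- by exists x2, z2.
Qed.

(** This enlarges [Z] to the third block. If [x] could not reach [z] within [D], some edge would
    leave the component of [x] in [D]; it enters [U] or [W], so it starts in [Z], whose vertices do
    reach [z] inside [D]. *)
Lemma connected_compl_blocks U W Z z :
    connected_in E Z -> z \in Z -> [disjoint U & Z] -> [disjoint W & Z] ->
    (forall s t, s \in U -> t \notin U -> adjacent E s t -> t \in Z) ->
    (forall s t, s \in W -> t \notin W -> adjacent E s t -> t \in Z) ->
  connected_in E (~: (U :|: W)).
Proof.
move=> cZ zZ dUZ dWZ outU outW; set D := ~: (U :|: W).
have sZD : Z \subset D.
  apply/subsetP => y yZ; rewrite !inE.
  by rewrite (disjointFl dUZ yZ) (disjointFl dWZ yZ).
apply: (@connected_in_center _ _ _ z) => x xD; apply: contraT => ncxz.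
pose S := [set y | connect (induced E D) x y].
have xS : x \in S by rewrite inE.
have zS : z \notin S by rewrite inE.
have [s [t [sS tS st]]] := connect_exit (biconnE.1 x z) xS zS.
have cxs : connect (induced E D) x s by rewrite inE in sS.
have sD := connect_induced_mem xD cxs.
have /negP[] : s \notin Z.
  apply: contra ncxz => sZ; apply: connect_trans cxs _.
  exact: connect_inducedS sZD (cZ _ _ sZ zZ).
have tD : t \notin D.
  apply: contra tS => tD; rewrite inE; apply: connect_trans cxs _.
  by apply: connect1; apply/and3P.
move: tD; rewrite !inE negbK in sD *; move: sD; rewrite negb_or.
case/andP=> sU sW /orP[tU|tW].
  by apply: outU tU sU _; rewrite adjacentC.
by apply: outW tW sW _; rewrite adjacentC.
Qed.

(** The blocks are the component of [a] in [A], that of [b] in [B], and all remaining vertices.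
    Since no edge joins [A] to [B], an edge leaving either component ends in [Z]. *)
Lemma disconnected_compl_not_separable Z A B a b :
    connected_in E Z -> [disjoint A & Z] -> [disjoint B & Z] ->
    [disjoint A & B] -> (forall v, [|| v \in A, v \in B | v \in Z]) ->
    (forall s t, s \in A -> t \in B -> ~~ adjacent E s t) ->
    a \in A -> b \in B ->
  ~ separable_graph R E.
Proof.
move=> cZ dAZ dBZ dAB cover nAB aA bB.
have [U [aU sUA cU clU]] := component_of E aA.
have [W [bW sWB cW clW]] := component_of E bB.
have outU s t : s \in U -> t \notin U -> adjacent E s t -> t \in Z.
  move=> sU tU st; case/or3P: (cover t) => // tB.
    by case/negP: tU; apply: clU tB sU _; rewrite adjacentC.
  by case/negP: (nAB s t (subsetP sUA s sU) tB).
have outW s t : s \in W -> t \notin W -> adjacent E s t -> t \in Z.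
  move=> sW tW st; case/or3P: (cover t) => // tA.
    by case/negP: (nAB t s tA (subsetP sWB s sW)); rewrite adjacentC.
  by case/negP: tW; apply: clW tA sW _; rewrite adjacentC.
have dUZ : [disjoint U & Z] := disjointWl sUA dAZ.
have dWZ : [disjoint W & Z] := disjointWl sWB dBZ.
have dUW : [disjoint U & W] := disjointW sUA sWB dAB.
have bU : b \notin U by rewrite (disjointFl dUW bW).
have aW : a \notin W by rewrite (disjointFr dUW aU).
have bZ : b \notin Z by rewrite (disjointFr dBZ bB).
have aZ : a \notin Z by rewrite (disjointFr dAZ aA).
have linkU := doubly_linked_component aU bU bZ dUZ outU.
have linkW := doubly_linked_component bW aW aZ dWZ outW.
(* A point of [Z] is read off an edge joining it to [U]. *)
have [_ [_ [_ _ [_ [z [_ zZ _ _]]]]]] := linkU.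
have sZ : Z \subset ~: (U :|: W).
  apply/subsetP => y yZ; rewrite !inE.
  by rewrite (disjointFl dUZ yZ) (disjointFl dWZ yZ).
have wide D : doubly_linked E D Z -> doubly_linked E D (~: (U :|: W)).
  case=> f [g [nefg [x1 [z1 [? z1Z ? ?]]] [x2 [z2 [? z2Z ? ?]]]]].
  exists f, g; split=> //; [exists x1, z1|exists x2, z2];
    by split=> //; apply: (subsetP sZ).
move=> sepE; apply: (@blocks_not_separable R V E U W (~: (U :|: W))) => //.
- exact: (connected_compl_blocks cZ zZ dUZ dWZ outU outW).
- by rewrite disjoints_subset setCK subsetUl.
- by rewrite disjoints_subset setCK subsetUr.
- by move=> v; rewrite !inE; case: (v \in U); case: (v \in W).
- exact: wide.
- exact: wide.
Qed.

(** * Chords of a Hamiltonian cycle *)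

Lemma doubly_linked_path x y a p :
    x != y -> x \notin a :: p -> y \notin a :: p ->
    path (adjacent E) x (rcons (a :: p) y) ->
  doubly_linked E [set v in a :: p] [set x; y].
Proof.
move=> nexy xp yp; rewrite rcons_path /= => /andP[/andP[xa _] ly].
(* The first and last edges of the path differ even if [p] is empty: only the first contains [x]. *)
exists [set x; a], [set last a p; y]; split.
- apply/eqP => /setP/(_ x); rewrite !inE eqxx (negPf nexy) orbF /=.
  by move/esym/eqP=> xl; case/negP: xp; rewrite xl mem_last.
- exists a, x; rewrite !inE !eqxx; split=> //; first by rewrite setUC.
- by exists (last a p), y; rewrite !inE -in_cons mem_last eqxx orbT.
Qed.

(** The third block is [{x, y}], connected by the chord itself; each open arc is joined to [x] at
    one end and to [y] at the other. *)
Lemma chord_not_separable c x y :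
    cycle (adjacent E) c -> uniq c -> (forall v, v \in c) ->
    adjacent E x y -> x != y -> y != next c x -> x != next c y ->
  ~ separable_graph R E.
Proof.
move=> cyc Uc memc xy nexy ynx xny.
have [i p1 p2 _ _ rotc] := rot_to_arc Uc (memc x) (memc y) nexy.
have Ur : uniq (x :: p1 ++ y :: p2) by rewrite -rotc rot_uniq.
have cycr : cycle (adjacent E) (x :: p1 ++ y :: p2) by rewrite -rotc rot_cycle.
have memr v : v \in x :: p1 ++ y :: p2 by rewrite -rotc mem_rot.
rewrite -(next_rot i Uc) rotc in ynx; rewrite -(next_rot i Uc) rotc in xny.
(* Neither arc is empty: an empty [p1] would make [y] the successor of [x], an empty [p2] would make
   [x] that of [y]. *)
case: p1 => [|a p1] in rotc Ur cycr memr ynx xny.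
  by rewrite /= eqxx eqxx in ynx.
case: p2 => [|b p2] in rotc Ur cycr memr ynx xny.
  have rot2 : rot (size (x :: a :: p1)) (x :: (a :: p1) ++ [:: y])
      = [:: y, x, a & p1] by rewrite -cat_cons rot_size_cat.
  by rewrite -(next_rot (size (x :: a :: p1)) Ur) rot2 /= eqxx eqxx in xny.
have [ep1 ep2] : path (adjacent E) x (rcons (a :: p1) y)
    /\ path (adjacent E) y (rcons (b :: p2) x).
  by move: cycr; rewrite /cycle -cat_rcons rcons_cat cat_path last_rcons =>
    /andP[].
have := Ur; rewrite -cat_cons cat_uniq => /and3P[/andP[xp1 _] /hasPn disj].
case/andP=> yp2 _.
have yp1 : y \notin a :: p1.
  by have := disj y (mem_head _ _); rewrite in_cons negb_or => /andP[].
have p2p1 v : v \in b :: p2 -> v \notin x :: a :: p1.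
  by move=> vp2; apply: disj; rewrite in_cons vp2 orbT.
have xp2 : x \notin b :: p2.
  by apply/negP => /p2p1; rewrite mem_head.
have conn d s z t : path (adjacent E) t (rcons (d :: s) z) ->
    connected_in E [set v in d :: s].
  by rewrite rcons_path => /andP[/andP[_ /connected_in_path]].
move=> sepE; apply: (@blocks_not_separable R V E [set v in a :: p1]
  [set v in b :: p2] [set x; y]) => //.
- exact: conn ep1.
- exact: conn ep2.
- apply: (@connected_in_center _ _ _ x) => v /set2P[] -> //.
  apply: connect1; apply/and3P; rewrite !inE !eqxx orbT; split=> //.
  by rewrite adjacentC.
- rewrite disjoint_sym disjoints_subset; apply/subsetP => v.
  rewrite in_setC ![_ \in [set _ in _]]inE => /p2p1.
  by rewrite in_cons negb_or => /andP[].
- rewrite disjoint_sym disjoints_subset; apply/subsetP => v.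
  by rewrite in_setC [_ \in [set _ in _]]inE => /set2P[] ->.
- rewrite disjoint_sym disjoints_subset; apply/subsetP => v.
  by rewrite in_setC [_ \in [set _ in _]]inE => /set2P[] ->.
- move=> v; have := memr v; rewrite !inE mem_cat !inE.
  by do ![case: (_ == _) => //=]; do ![case: (_ \in _) => //=].
- exact: doubly_linked_path.
- by rewrite setUC; apply: doubly_linked_path; rewrite // eq_sym.
Qed.

(** * Spanning arcs and a Hamiltonian cycle *)

Lemma connect_end K L u v x :
    u != v -> x \in K -> u \notin K -> v \notin K ->
    (forall z, [|| z \in K, z \in L | z \in [set u; v]]) ->
    (forall s t, s \in K -> t \in L -> ~~ adjacent E s t) ->
  connect (induced E ([set u; v] :|: K)) x u.
Proof.
move=> neuv xK uK vK cover nKL; set D := _ :|: K.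
have sKD : K \subset D by apply: subsetUr.
pose S := [set z in K | connect (induced E D) x z].
have xS : x \in S by rewrite inE xK /=.
have uS : u \notin S by rewrite inE (negPf uK).
have xv : x \in [set~ v] by rewrite !inE; apply: contraNneq vK => <-.
have uv : u \in [set~ v] by rewrite !inE.
(* A path from [x] to [u] avoiding [v] can leave [K] only into [u], as no edge joins [K] to [L]. *)
have cxu := biconnected_del biconnE xv uv.
have [s [t [+ tS /and3P[_ + st]]]] := connect_exit cxu xS uS.
rewrite !inE => /andP[sK cxs] tv.
have tD : t \in D.
  case/or3P: (cover t) => tB; first exact: (subsetP sKD).
    by case/negP: (nKL s t sK tB).
  by rewrite inE tB.
have cxt : connect (induced E D) x t.
  apply: connect_trans cxs _; apply: connect1; apply/and3P.
  by rewrite (subsetP sKD).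
move: tS tD; rewrite !inE cxt andbT (negPf tv) => /negPf->.
by rewrite !orbF => /eqP <-.
Qed.

(** A simple path from [u] to [v] through [K] must cover [K]: its vertex set is connected, and a
    missed vertex of [K] would be separated from [L] in the complement, contradicting
    separability. *)
Lemma spanning_arc K L u v x y :
    separable_graph R E -> u != v -> x \in K -> y \in L ->
    [disjoint K & L] -> [disjoint K & [set u; v]] -> [disjoint L & [set u; v]] ->
    (forall z, [|| z \in K, z \in L | z \in [set u; v]]) ->
    (forall s t, s \in K -> t \in L -> ~~ adjacent E s t) ->
  exists p, [/\ path (adjacent E) u (rcons p v), uniq p
    & forall z, (z \in p) = (z \in K)].
Proof.
move=> sepE neuv xK yL dKL dKe dLe cover nKL.
have uK : u \notin K by rewrite (disjointFl dKe) // !inE eqxx.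
have vK : v \notin K by rewrite (disjointFl dKe) // !inE eqxx orbT.
have cxu := connect_end neuv xK uK vK cover nKL.
have cxv : connect (induced E ([set u; v] :|: K)) x v.
  rewrite setUC in cover *.
  by apply: connect_end cover nKL => //; rewrite eq_sym.
set D := _ :|: K in cxu cxv.
have : connect (induced E D) u v.
  by apply: connect_trans cxv; rewrite induced_connectC.
case/connectP=> p0 /shortenP[p1 ep Up _] {p0} lastp.
case: (lastP p1) ep Up lastp => [|p v'] ep Up.
  by move=> vu; rewrite vu eqxx in neuv.
rewrite last_rcons => v'v; rewrite -{v'}v'v in ep Up.
have uD : u \in D by rewrite !inE eqxx.
have eap : path (adjacent E) u (rcons p v).
  by apply: sub_path ep => s t /and3P[].
have [/andP[up vp] Up'] : (u \notin p) && (v \notin p) /\ uniq p.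
  move: Up; rewrite /= mem_rcons in_cons negb_or rcons_uniq.
  by case/and3P=> /andP[_ ->] -> ->.
have spK z : z \in p -> z \in K.
  move=> zp; have : z \in D.
    apply: (connect_induced_mem uD); apply: (path_connect ep).
    by rewrite in_cons mem_rcons in_cons zp !orbT.
  rewrite !inE => /orP[/orP[]|//] /eqP zE; first by rewrite -zE zp in up.
  by rewrite -zE zp in vp.
exists p; split=> // z; apply/idP/idP; first exact: spK.
move=> zK; apply: contraT => zp.
have cZ := connected_in_path eap.
set Z := finset _ in cZ.
have memZ t : (t \in Z) = [|| t == u, t == v | t \in p].
  by rewrite inE in_cons mem_rcons in_cons.
exfalso; move: sepE.
apply: (@disconnected_compl_not_separable Z (K :\: Z) L z y) => //.
- by rewrite disjoint_sym disjoints_subset setCD subsetUr.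
- rewrite disjoint_sym disjoints_subset; apply/subsetP => t.
  rewrite memZ inE => /or3P[/eqP->|/eqP->|/spK tK].
  + by rewrite (disjointFl dLe) // !inE eqxx.
  + by rewrite (disjointFl dLe) // !inE eqxx orbT.
  + by rewrite (disjointFr dKL tK).
- exact: disjointWl (subsetDl _ _) dKL.
- move=> t; rewrite in_setD memZ; case/or3P: (cover t) => [->|->|].
  + by rewrite andbT orbCA orNb orbT.
  + by rewrite orbT.
  + by rewrite !inE => /orP[] ->; rewrite ?orbT.
- by move=> s t /setDP[sK _]; apply: nKL.
- rewrite in_setD memZ zK (negPf zp) orbF andbT negb_or.
  by apply/andP; split; [apply: contraNneq uK => <-|apply: contraNneq vK => <-].
Qed.

Lemma separable_Hamiltonian : separable_graph R E -> 1 < #|V| ->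
  exists c, [/\ uniq c, forall v, v \in c & cycle (adjacent E) c].
Proof.
move=> sepE cardV.
have [/existsP[u /existsP[v /andP[neuv nuv]]]|complete] :=
  boolP [exists u, exists v, (u != v) && ~~ adjacent E u v].
- pose Z := [set~ u] :\ v.
  have memZ z : (z \in Z) = (z != v) && (z != u) by rewrite !inE.
  (* If [Z] were connected, its complement would be [{u, v}] without an edge, which separability
     excludes. *)
  have [/forallP cZ|ncZ] := boolP [forall x, forall y,
    (x \in Z) ==> (y \in Z) ==> connect (induced E Z) x y].
    exfalso; move: sepE.
    apply: (@disconnected_compl_not_separable Z [set u] [set v] u v);
      rewrite ?set11 //.
    + by move=> x y xZ yZ; move/forallP: (cZ x) => /(_ y); rewrite xZ yZ.
    + by rewrite disjoints1 memZ eqxx andbF.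
    + by rewrite disjoints1 memZ eqxx.
    + by rewrite disjoints1 in_set1.
    + by move=> t; rewrite memZ !in_set1; do 2!case: (_ == _).
    + by move=> s t /set1P-> /set1P->.
  have [x [y [xZ yZ ncxy]]] : exists x y,
      [/\ x \in Z, y \in Z & ~~ connect (induced E Z) x y].
    move: ncZ; rewrite negb_forall => /existsP[x]; rewrite negb_forall.
    by case/existsP=> y; rewrite !negb_imply => /and3P[]; exists x, y.
  pose K := [set z | connect (induced E Z) x z]; pose L := Z :\: K.
  have sKZ : K \subset Z.
    by apply/subsetP => z; rewrite inE; apply: connect_induced_mem.
  have xK : x \in K by rewrite inE.
  have yL : y \in L by rewrite in_setD yZ inE ncxy.
  have dKL : [disjoint K & L].
    by rewrite disjoint_sym disjoints_subset subDset setUCr subsetT.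
  have dZe : [disjoint Z & [set u; v]].
    rewrite disjoint_sym disjoints_subset; apply/subsetP => z.
    by rewrite in_setC memZ => /set2P[] ->; rewrite eqxx ?andbF.
  have dKe : [disjoint K & [set u; v]] := disjointWl sKZ dZe.
  have dLe : [disjoint L & [set u; v]] := disjointWl (subsetDl _ _) dZe.
  have cover z : [|| z \in K, z \in L | z \in [set u; v]].
    rewrite in_setD memZ in_set2.
    by do !case: (_ \in _); do !case: (_ == _).
  have nKL s t : s \in K -> t \in L -> ~~ adjacent E s t.
    move=> sK /setDP[tZ]; apply: contra => st; have sZ := subsetP sKZ s sK.
    rewrite !inE in sK *; apply: connect_trans sK _; apply: connect1.
    by apply/and3P; rewrite sZ tZ.
  have [p [ep Up memp]] :=
    spanning_arc sepE neuv xK yL dKL dKe dLe cover nKL.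
  (* The return arc: exchange [K] with [L] and [u] with [v]. *)
  have [q [eq Uq memq]] : exists q, [/\ path (adjacent E) v (rcons q u), uniq q
      & forall z, (z \in q) = (z \in L)].
    apply: (@spanning_arc L K v u y x); rewrite 1?disjoint_sym 1?eq_sym //.
    - by rewrite setUC disjoint_sym.
    - by rewrite setUC disjoint_sym.
    - by move=> z; rewrite orbCA setUC.
    - by move=> s t sL tK; rewrite adjacentC nKL.
  exists (u :: p ++ v :: q); split.
  - rewrite -cat_cons cat_uniq /= Up Uq !memp !memq.
    rewrite (disjointFl dKe) ?set21 // (disjointFl dLe) ?set22 //=.
    rewrite andbT in_cons memp (disjointFl dKe) ?set22 // orbF.
    rewrite eq_sym (negPf neuv).
    apply/hasPn => z; rewrite memq => zL; rewrite in_cons memp.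
    rewrite (disjointFl dKL zL) orbF; apply: contraTneq zL => ->.
    by rewrite (disjointFl dLe) ?set21.
  - move=> z; rewrite in_cons mem_cat in_cons memp memq.
    have := cover z; rewrite in_set2.
    by do !case: (_ == _); do !case: (_ \in _).
  - by rewrite /cycle -cat_rcons rcons_cat cat_path last_rcons ep.
have adj s t : s != t -> adjacent E s t.
  move: complete; rewrite negb_exists => /forallP/(_ s).
  rewrite negb_exists => /forallP/(_ t); rewrite negb_and !negbK.
  by case: (s == t).
exists (enum V); split; [exact: enum_uniq|by move=> v; rewrite mem_enum|].
move: (enum_uniq V) cardV; rewrite cardE; case: (enum V) => // a s Us sz.
rewrite /cycle rcons_path; apply/andP; split.
  apply: (@pairwise_sorted _ _ (a :: s)); move: Us; rewrite uniq_pairwise.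
  by apply: sub_pairwise => x y /adj.
(* The closing edge joins two distinct vertices because [1 < #|V|]. *)
case/lastP: s Us sz => // s b; rewrite last_rcons cons_uniq => /andP[+ _] _.
by rewrite mem_rcons in_cons negb_or eq_sym => /andP[/adj].
Qed.

End NonSeparability.

Theorem theorem5 (R : realType) (V : finType) (E : {set {set V}})
  (simpleE : simple_graph E) (biconnE : biconnected E) (cardV : 3 <= #|V|)
  (not_cycle : ~ elementary_cycle E) :
  ~ separable_graph R E.
Proof.
move=> sepE; apply: not_cycle.
have [c [Uc memc cyc]] := separable_Hamiltonian biconnE sepE (ltnW cardV).
exists c; split=> //.
  by rewrite -(card_uniqP Uc) (eq_card (B := V)) // => v; rewrite memc.
apply/setP => f; apply/idP/imsetP => [fE|[x _ ->]]; last first.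
  exact: next_cycle cyc (memc x).
have /eqP/cards2P[x [y [nexy fxy]]] := simpleE f fE.
rewrite fxy in fE *.
(* An edge whose ends are not consecutive on [c] in either direction is a chord, excluded by
   separability. *)
have [->|ynx] := eqVneq y (next c x); first by exists x.
have [->|xny] := eqVneq x (next c y); first by exists y; rewrite // setUC.
by case: (chord_not_separable cyc Uc memc fE nexy ynx xny sepE).
Qed.
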